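(* Let $h\ge1$, $\omega=e^{2\pi\mathrm{i}/h}$, and consider walks with steps in $\{\pm1,\dots,\pm h\}$. For $k\ge1$ and $n\ge0$, the number of positive walks of length $n$ from the origin to altitude $k$ (walks $0=y_0,\dots,y_n=k$ with $y_i\ge1$ for $1\le i\le n$) and the number of positive meanders of length $n$ (walks $0=y_0,\dots,y_n$ with $y_i\ge1$ for $1\le i\le n$) are respectively $$[z^n]G_{0,k}(z)=\sum_{n_1+\dots+n_h=nh}\ \sum_{i_1+\dots+i_h=k}\ \prod_{j=1}^h\frac{i_j}{n_j}\binom{n_j/h}{n_j-i_j}^{*}_{2h}\ \omega^{\sum_{j=1}^h(j-1)n_j},$$ $$[z^n]M_{>0}(z)=\sum_{n_1+\dots+n_h=nh}\ \sum_{i_1,\dots,i_h\ge0}\ \prod_{j=1}^h\frac{i_j}{n_j}\binom{n_j/h}{n_j-i_j}^{*}_{2h}\ \omega^{\sum_{j=1}^h(j-1)n_j},$$ where all $n_j,i_j$ range over nonnegative integers.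
   Context: For real $\alpha$ and integer $k$, $\binom{\alpha}{k}^{*}_{2h}:=[u^k](1+u+\dots+u^{h-1}+u^{h+1}+\dots+u^{2h})^{\alpha}$ (formal power series with constant term $1$; $0$ for $k<0$). In the products, the factor $\frac{i}{n}\binom{n/h}{n-i}^{*}_{2h}$ stands for $[z^n]U^i(z)$, where $U(z)=z+\cdots$ is the power series root of $1-z^h(U^{-h}+\dots+U^{-1}+U+\dots+U^{h})=0$; concretely it equals $1$ if $i=n=0$ and $0$ if exactly one of $i,n$ is $0$. *)

(* Defs.v *)
From HB Require Import structures.
From mathcomp Require Import all_boot all_order all_algebra.
From mathcomp Require Import reals trigo.
From mathcomp Require Import complex.
Set Implicit Arguments. Unset Strict Implicit. Unset Printing Implicit Defensive.
Import Order.TTheory GRing.Theory Num.Theory.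
Local Open Scope ring_scope.

Definition step (h : nat) (j : 'I_(2 * h)) : int :=
  if (j < h)%N then (j.+1)%:Z else - ((j - h).+1)%:Z.

Definition alt (h n : nat) (w : {ffun 'I_n -> 'I_(2 * h)}) (i : nat) : int :=
  \sum_(l < n | (l < i)%N) step (w l).

Definition positive_walk (h n : nat) (w : {ffun 'I_n -> 'I_(2 * h)}) : bool :=
  [forall i : 'I_n.+1, (0 < i)%N ==> (1 <= alt w i)].

Definition nb_pos_walks (h n : nat) (k : int) : nat :=
  #|[set w : {ffun 'I_n -> 'I_(2 * h)} | positive_walk w && (alt w n == k)]|.

Definition nb_pos_meanders (h n : nat) : nat :=
  #|[set w : {ffun 'I_n -> 'I_(2 * h)} | positive_walk w]|.

Definition gbinom (F : fieldType) (a : F) (m : nat) : F :=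
  (\prod_(l < m) (a - l%:R)) / (m`!)%:R.

Definition Qpoly (F : fieldType) (h : nat) : {poly F} :=
  \sum_(1 <= j < (2 * h).+1 | j != h) 'X^j.

(* [u^k] (1 + Q(u))^a = sum_{m <= k} binom(a,m) [u^k] Q(u)^m  (Q has no constant term) *)
Definition binomstar (F : fieldType) (h : nat) (a : F) (k : nat) : F :=
  \sum_(m < k.+1) gbinom a m * ((Qpoly F h) ^+ m)`_k.

Definition ufactor (F : fieldType) (h i n : nat) : F :=
  if (i == 0)%N && (n == 0)%N then 1
  else if (i == 0)%N || (n == 0)%N then 0
  else if (i <= n)%N then (i%:R / n%:R) * binomstar h (n%:R / h%:R) (n - i)
  else 0.

Definition omega (R : realType) (h : nat) : R[i] :=
  (cos (2 * pi / h%:R) +i* sin (2 * pi / h%:R))%C.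

(* Main.v *)
Require Import Defs.
From HB Require Import structures.
From mathcomp Require Import all_boot all_order all_algebra.
From mathcomp Require Import reals trigo.
From mathcomp Require Import complex.
From mathcomp Require Import ring lra zify.
Set Implicit Arguments. Unset Strict Implicit. Unset Printing Implicit Defensive.
Import Order.TTheory GRing.Theory Num.Theory.
Local Open Scope ring_scope.

(** Lagrange inversion turns [ufactor h i n] into the coefficient of [z^n] in
    [U^i]; concretely, [U = z (1 + Q(U))^(1/h)] is read off as a recurrence on
    these coefficients, from which their multiplicativity in [i] follows by
    induction on [n]. The [h] series [u_j = U(omega^j z)] are distinct roots of
    the kernel [K(u) = u^h - z^h (1 + Q(u))], so every divided difference of
    [u^k K(u)] at these points is zero. The divided differences of monomials are
    the complete homogeneous symmetric polynomials of the [u_j], and this says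
    [h_(k+1) = z^h * sum of h_(k+1-s)] over the steps [s] of the walk: the last
    step recurrence of positive walks. Hence walks ending at [k] are counted by
    [h_k(u_0, ..., u_(h-1))].

    Power series are represented by polynomials truncated at order [N]; since
    [u_i - u_j] has valuation 1, each divided difference loses one order of
    precision. *)

(** * Summation ranges and low-order coefficients *)

Lemma sum_ord_widen (V : nmodType) n m (f : nat -> V) :
  (n <= m)%N -> (forall i, (n <= i < m)%N -> f i = 0) ->
  \sum_(i < n) f i = \sum_(i < m) f i.
Proof.
move=> nm f0; rewrite (big_ord_widen m f nm) [RHS](bigID (fun i : 'I__ => i < n)%N) /=.
rewrite [X in _ + X]big1 ?addr0 // => i; rewrite -leqNgt => ni.
by rewrite f0 // ni ltn_ord.
Qed.

Lemma coef_exp_small (A : comNzRingType) (p : {poly A}) m k :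
  p`_0 = 0 -> (k < m)%N -> (p ^+ m)`_k = 0.
Proof.
move=> p0; elim: m k => [|m IH] k // km.
rewrite exprS coefM big1 // => -[[|i] ik] _ /=; first by rewrite p0 mul0r.
by rewrite IH ?mulr0 //; lia.
Qed.

(** * Generalized binomial coefficients *)

Section GeneralizedBinomial.
Variable F : numFieldType.
Implicit Types (a b : F).

Lemma gbinom0 a : gbinom a 0 = 1.
Proof. by rewrite /gbinom big_ord0 fact0 divr1. Qed.

Lemma gbinomS a m : m.+1%:R * gbinom a m.+1 = (a - m%:R) * gbinom a m.
Proof.
rewrite /gbinom big_ord_recr /= factS natrM.
have := pnatr_eq0 F m.+1; have := pnatr_eq0 F m`!.
rewrite (gtn_eqF (fact_gt0 m)) /= => /negbT m0 /negbT m1.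
by field; rewrite nat1r m0 m1.
Qed.

(** Coefficient form of d/dx (1+x)^a = a (1+x)^(a-1), used below to differentiate (1+Q)^a. *)
Lemma gbinom_pascal a m : m.+1%:R * gbinom a m.+1 = a * gbinom (a - 1) m.
Proof.
elim: m => [|m IH]; first by rewrite gbinomS !gbinom0 subr0.
apply: (@mulfI _ m.+1%:R); first by rewrite pnatr_eq0.
rewrite gbinomS [RHS]mulrCA gbinomS mulrCA IH -(natr1 m).
by ring.
Qed.

Lemma gbinom_vandermonde a b m :
  \sum_(l < m.+1) gbinom a l * gbinom b (m - l) = gbinom (a + b) m.
Proof.
elim: m => [|m IH].
  by rewrite big_ord_recl big_ord0 !gbinom0 mulr1 addr0.
apply: (@mulfI _ m.+1%:R); first by rewrite pnatr_eq0.
rewrite gbinomS -IH !mulr_sumr.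
(* The weight m+1 is split as i + (m+1-i): [gbinomS] then lowers one index in each sum, and the
   coefficients add up to (a-i) + (b-(m-i)) = a+b-m. *)
have -> : \sum_(i < m.+2) m.+1%:R * (gbinom a i * gbinom b (m.+1 - i)) =
  \sum_(i < m.+2) i%:R * gbinom a i * gbinom b (m.+1 - i) +
  \sum_(i < m.+2) gbinom a i * ((m.+1 - i)%:R * gbinom b (m.+1 - i)).
  rewrite -big_split /=; apply: eq_bigr => i _.
  by rewrite natrB -1?ltnS //; ring.
rewrite big_ord_recl !mul0r add0r.
rewrite [X in _ + X]big_ord_recr /= subnn mul0r mulr0 addr0 -big_split /=.
apply: eq_bigr => i _; rewrite /bump /= add1n gbinomS subSS subSn -1?ltnS //.
by rewrite gbinomS natrB -1?ltnS //; ring.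
Qed.

End GeneralizedBinomial.

(** * The power series (1 + Q(u))^a *)

Section BinomialSeries.
Variables (F : numFieldType) (h : nat).
Hypothesis hpos : (0 < h)%N.
Implicit Types (a b : F) (p q : {poly F}).

Lemma Qpoly_coef k :
  (Qpoly F h)`_k = ((0 < k)%N && (k < (2 * h).+1)%N && (k != h))%:R.
Proof.
rewrite /Qpoly coef_sum.
transitivity (\sum_(1 <= j < (2 * h).+1 | j != h) (k == j)%:R : F).
  by apply: eq_bigr => j _; rewrite coefXn.
case: (boolP (_ && _)) => [/andP[k1 kh]|kh].
  rewrite big_mkcond (bigD1_seq k) ?mem_index_iota ?iota_uniq //= kh eqxx.
  by rewrite big1 ?addr0 // => j jk; rewrite [k == j]eq_sym (negbTE jk) if_same.
rewrite big_seq_cond big1 // => j; rewrite mem_index_iota => /andP[j1 jh].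
by case: eqP => // kj; rewrite kj j1 jh in kh.
Qed.

Lemma coef_comp_low p q k : q`_0 = 0 ->
  (p \Po q)`_k = \sum_(i < k.+1) p`_i * (q ^+ i)`_k.
Proof.
move=> q0; rewrite coef_comp_poly.
pose f i := p`_i * (q ^+ i)`_k.
rewrite (@sum_ord_widen _ _ (maxn (size p) k.+1) f) ?leq_maxl //; last first.
  by move=> i /andP[pi _]; rewrite /f nth_default ?mul0r.
apply/esym/(@sum_ord_widen _ _ _ f); first exact: leq_maxr.
by move=> i /andP[ki _]; rewrite /f coef_exp_small ?mulr0.
Qed.

(** Truncating (1+x)^a keeps the substitution of Q polynomial; since Q has no constant term, the
    coefficients below u^N stay exact. *)
Definition gbinom_poly a N : {poly F} := \poly_(m < N) gbinom a m.
Definition gbinom_comp a N : {poly F} := gbinom_poly a N \Po Qpoly F h.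

Lemma Qpoly0 : (Qpoly F h)`_0 = 0.
Proof. by rewrite Qpoly_coef. Qed.

Lemma binomstarE a N k : (k < N)%N -> binomstar h a k = (gbinom_comp a N)`_k.
Proof.
move=> kN; rewrite /gbinom_comp coef_comp_low ?Qpoly0 //.
apply: eq_bigr => i _; rewrite coef_poly ifT //.
by apply: leq_trans kN; rewrite ltn_ord.
Qed.

Lemma binomstar0 a : binomstar h a 0 = 1.
Proof. by rewrite /binomstar big_ord1 gbinom0 mul1r expr0 coef1. Qed.

Lemma binomstar1 k : binomstar h (1 : F) k = ((k < (2 * h).+1)%N && (k != h))%:R.
Proof.
case: k => [|k]; first by rewrite binomstar0 eq_sym -lt0n hpos.
rewrite /binomstar big_ord_recl coef1 mulr0 add0r big_ord_recl /=.
rewrite /bump /= /gbinom !addn0 big_ord_recl big_ord0 subr0 divr1 !mul1r.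
rewrite expr1 Qpoly_coef /= big1 ?addr0 // => i _.
(* For m >= 2 the product in [gbinom 1 m] contains the factor 1 - 1. *)
by rewrite !big_ord_recl /= subrr mul0r mulr0 !mul0r.
Qed.

(** Substituting Q turns the Vandermonde convolution into (1+Q)^a (1+Q)^b = (1+Q)^(a+b). *)
Lemma binomstarD a b k :
  \sum_(l < k.+1) binomstar h a l * binomstar h b (k - l) = binomstar h (a + b) k.
Proof.
have -> : \sum_(l < k.+1) binomstar h a l * binomstar h b (k - l) =
   (gbinom_comp a k.+1 * gbinom_comp b k.+1)`_k.
  rewrite coefM; apply: eq_bigr => i _.
  by rewrite !(@binomstarE _ k.+1) // ltnS leq_subr.
rewrite (@binomstarE _ k.+1) // -comp_polyM !coef_comp_low ?Qpoly0 //.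
apply: eq_bigr => i _; congr (_ * _); rewrite coef_poly ltn_ord.
rewrite coefM -gbinom_vandermonde; apply: eq_bigr => l _.
rewrite !coef_poly !ifT //; have := ltn_ord i; have := ltn_ord l; lia.
Qed.

(* Euler operator [u d/du] applied to [(1 + Q)^a]. *)
Lemma binomstar_euler a k :
  k%:R * binomstar h a k =
  a * \sum_(l < k.+1) (l%:R * (Qpoly F h)`_l) * binomstar h (a - 1) (k - l).
Proof.
case: k => [|k]; first by rewrite mul0r big_ord1 !mul0r mulr0.
rewrite big_ord_recl !mul0r add0r.
transitivity ((gbinom_comp a k.+2)^`())`_k.
  by rewrite coef_deriv (@binomstarE _ k.+2) // mulr_natl.
rewrite deriv_comp.
have -> : (gbinom_poly a k.+2)^`() = a *: gbinom_poly (a - 1) k.+1 :> {poly F}.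
  apply/polyP => i; rewrite coef_deriv coefZ !coef_poly ltnS.
  by case: ifP; rewrite ?mul0rn ?mulr0 // -mulr_natl gbinom_pascal.
rewrite comp_polyZ -scalerAl coefZ coefMr; congr (_ * _).
apply: eq_bigr => i _; rewrite lift0 subSS coef_deriv mulrC -[_ *+ i.+1]mulr_natl.
by rewrite (@binomstarE _ k.+1) // ltnS leq_subr.
Qed.

(** With f = 1+Q and D = u d/du, the series D(f^a) f^b = a f^(a+b-1) D f and D(f^(a+b)) = (a+b)
    f^(a+b-1) D f are proportional. This evaluates the sums weighted by l in the Lagrange
    recurrence. *)
Lemma binomstar_eulerD a b k :
  (a + b) * \sum_(l < k.+1) (l%:R * binomstar h a l) * binomstar h b (k - l) =
  a * (k%:R * binomstar h (a + b) k).
Proof.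
pose bs c : {poly F} := \poly_(i < k.+1) binomstar h c i.
pose e : {poly F} := \poly_(i < k.+1) (i%:R * (Qpoly F h)`_i).
have coefbs c i : (i <= k)%N -> (bs c)`_i = binomstar h c i.
  by move=> ik; rewrite coef_poly ltnS ik.
have bsM c d i : (i <= k)%N -> (bs c * bs d)`_i = (bs (c + d))`_i.
  move=> ik; rewrite coefbs // -binomstarD coefM; apply: eq_bigr => l _.
  have := ltn_ord l => li.
  by rewrite !coefbs //; lia.
have eulerE c i : (i <= k)%N ->
    i%:R * binomstar h c i = c * (e * bs (c - 1))`_i.
  move=> ik; rewrite binomstar_euler coefM; congr (_ * _).
  apply: eq_bigr => l _; have := ltn_ord l => li.
  by rewrite coefbs ?coef_poly ?ifT //; lia.
transitivity ((a + b) * (a * (e * bs (a - 1) * bs b)`_k)).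
  congr (_ * _); rewrite [X in a * X]coefM mulr_sumr; apply: eq_bigr => l _.
  have := ltn_ord l => lk.
  by rewrite eulerE ?coefbs ?mulrA //; lia.
rewrite eulerE // mulrCA -mulrA; congr (_ * (_ * _)).
rewrite [LHS]coefM [RHS]coefM; apply: eq_bigr => i _; have := ltn_ord i => ik.
by rewrite addrAC bsM //; lia.
Qed.

End BinomialSeries.

(** * Coefficients of the powers of U *)

Section LagrangeCoefficients.
Variables (F : numFieldType) (h : nat).
Hypothesis hpos : (0 < h)%N.
Local Notation c := (ufactor F h).

Lemma ufactor0n n : c 0 n = (n == 0)%:R.
Proof. by case: n. Qed.

Lemma ufactorn0 i : c i 0 = (i == 0)%:R.
Proof. by case: i. Qed.

Lemma ufactor_gt i n : (n < i)%N -> c i n = 0.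
Proof. by case: i n => [|i] [|n] //; rewrite /ufactor /= ltnNge => /negbTE ->. Qed.

Lemma ufactorE i k :
  (0 < i + k)%N -> c i (i + k) = i%:R / (i + k)%:R * binomstar h ((i + k)%:R / h%:R) k.
Proof.
case: i => [|i] ik; first by rewrite ufactor0n eqn0Ngt ik !mul0r.
by rewrite /ufactor /= leq_addr addKn.
Qed.

Lemma natr_neq0 n : (0 < n)%N -> n%:R != 0 :> F.
Proof. by rewrite pnatr_eq0 -lt0n. Qed.

(* The Lagrange equation [U = z (1 + Q(U))^(1/h)], raised to the power [d] and
   multiplied by [U^i]. *)
Lemma ufactor_step d i m : (0 < d)%N ->
  c (i + d) (m + d) =
  \sum_(l < m.+1) binomstar h (d%:R / h%:R : F) l * c (i + l) m.
Proof.
move=> d0; case: (ltnP m i) => [mi|im].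
  rewrite ufactor_gt ?ltn_add2r // big1 // => l _.
  by rewrite ufactor_gt ?mulr0 // ltn_addr.
case: m im => [|m] im.
  move: im; rewrite leqn0 => /eqP->.
  rewrite add0n -{2}[d]addn0 ufactorE ?addn0 // divff ?natr_neq0 //.
  by rewrite big_ord1 /= !binomstar0.
have h0 := natr_neq0 hpos; have d1 := natr_neq0 d0.
have m1 : m.+1%:R != 0 :> F by rewrite natr_neq0.
have [k mik] : exists k, m.+1 = (i + k)%N by exists (m.+1 - i)%N; rewrite subnKC.
set b := binomstar h ((m.+1 + d)%:R / h%:R : F) k.
have bD : d%:R / h%:R + m.+1%:R / h%:R = (m.+1 + d)%:R / h%:R :> F.
  by rewrite -mulrDl -natrD addnC.
have -> : c (i + d) (m.+1 + d) = (i + d)%:R / (m.+1 + d)%:R * b.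
  have E : (m.+1 + d = (i + d) + k)%N by lia.
  by rewrite /b {1 2}E ufactorE -?E //; lia.
(* The factor i+l of [c (i + l) m.+1] is split: the part i sums to i b by [binomstarD], the part l
   to d k b / (m+1+d) by [binomstar_eulerD]. As k = m+1-i, the total is (m+1)(i+d) b / (m+1+d). *)
transitivity (m.+1%:R^-1 * (\sum_(l < k.+1)
    (i%:R * binomstar h (d%:R / h%:R) l * binomstar h (m.+1%:R / h%:R : F) (k - l)
  + l%:R * binomstar h (d%:R / h%:R) l * binomstar h (m.+1%:R / h%:R : F) (k - l)))).
  rewrite big_split /=.
  under eq_bigr do rewrite -mulrA.
  rewrite -mulr_sumr binomstarD // bD -/b.
  have := @binomstar_eulerD F h hpos (d%:R / h%:R) (m.+1%:R / h%:R) k.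
  rewrite bD -/b; set S := \sum_(l < _) _ => HS.
  have {HS} -> : S = d%:R / (m.+1 + d)%:R * (k%:R * b).
    apply: (@mulfI _ ((m.+1 + d)%:R / h%:R)).
      by rewrite mulf_neq0 ?invr_eq0 ?natr_neq0 // addn_gt0.
    rewrite HS; have := @natr_neq0 (m.+1 + d) isT.
    by move: (m.+1 + d)%:R h0 => x h0 x0; field; rewrite x0.
  have -> : k%:R = (m.+1%:R - i%:R) :> F by rewrite mik natrD addrC addKr.
  have := @natr_neq0 (m.+1 + d) isT; rewrite !natrD.
  by move: m.+1%:R m1 => x m1 x0; field; rewrite x0.
rewrite mulr_sumr.
rewrite -(@sum_ord_widen _ k.+1 _
  (fun l => binomstar h (d%:R / h%:R : F) l * c (i + l) m.+1)); first last.
- by move=> l /andP[kl _]; rewrite ufactor_gt ?mulr0 //; lia.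
- by lia.
apply: eq_bigr => l _; have := ltn_ord l => lk.
have -> : c (i + l) m.+1 =
    (i%:R + l%:R) / m.+1%:R * binomstar h (m.+1%:R / h%:R : F) (k - l).
  have E : (m.+1 = (i + l) + (k - l))%N by lia.
  by rewrite {1}E ufactorE -?E // natrD.
by ring.
Qed.

(** U^i U^j = U^(i+j). For i > 0, [ufactor_step] with d = 1 expands both sides over [c (i + l)] with
    the same weights, which reduces order n+1 to order n. *)
Lemma ufactorM i j n :
  \sum_(m < n.+1) c i m * c j (n - m) = c (i + j) n.
Proof.
elim: n i => [|n IH] [|i].
- by rewrite big_ord1 !ufactor0n eqxx mul1r.
- by rewrite big_ord1 /= !ufactorn0 mul0r.
- rewrite big_ord_recl ufactor0n eqxx mul1r subn0 big1 ?addr0 // => l _.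
  by rewrite ufactor0n mul0r.
rewrite big_ord_recl ufactorn0 mul0r add0r.
(* The range of l is made independent of m, so that the two sums can be exchanged. *)
have step1 k m : (m <= n)%N ->
    c k.+1 m.+1 = \sum_(l < n.+1) binomstar h (1 / h%:R : F) l * c (k + l) m.
  move=> mn; rewrite -addn1 -(addn1 m) ufactor_step //.
  apply: (@sum_ord_widen _ _ _
    (fun l => binomstar h (1 / h%:R : F) l * c (k + l) m)) => // l /andP[ml _].
  by rewrite ufactor_gt ?mulr0 //; lia.
rewrite addSn step1 //.
transitivity (\sum_(m < n.+1) \sum_(l < n.+1)
    binomstar h (1 / h%:R : F) l * (c (i + l) m * c j (n - m))).
  apply: eq_bigr => m _; rewrite lift0 subSS step1 -1?ltnS // mulr_suml.
  by apply: eq_bigr => l _; rewrite mulrA.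
rewrite exchange_big; apply: eq_bigr => l _.
by rewrite -mulr_sumr IH addnAC.
Qed.

(** The kernel equation U^h = z^h (1 + Q(U)): for d = h the exponent d/h is 1, and the binomial
    series reduces to 1 + Q. *)
Lemma ufactor_hstep m :
  c h (m + h) = \sum_(l < (2 * h).+1 | l != h :> nat) c l m.
Proof.
have := @ufactor_step h 0 m hpos; rewrite add0n => ->.
rewrite divff ?natr_neq0 //.
under eq_bigr do rewrite binomstar1 // add0n.
pose f l := ((l < (2 * h).+1)%N && (l != h))%:R * c l m.
rewrite (@sum_ord_widen _ _ (m.+1 + (2 * h).+1) f) ?leq_addr //; last first.
  by move=> l /andP[ml _]; rewrite /f ufactor_gt ?mulr0.
rewrite [RHS]big_mkcond /=.
have -> : \sum_(l < (2 * h).+1) (if l != h :> nat then c l m else 0) =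
          \sum_(l < (2 * h).+1) f l.
  by apply: eq_bigr => l _; rewrite /f ltn_ord /=; case: ifP; rewrite ?mul1r ?mul0r.
apply/esym/sum_ord_widen; first exact: leq_addl.
by move=> l /andP[hl _]; rewrite /f ltnNge hl /= mul0r.
Qed.

End LagrangeCoefficients.

(** * Complete homogeneous symmetric polynomials and formal divided differences *)

Section CompleteHomogeneous.
Variable A : comNzRingType.
Implicit Types (s : seq A) (p q : {poly A}).

Fixpoint hsym s (k : nat) : A :=
  if s is x :: s' then \sum_(i < k.+1) x ^+ i * hsym s' (k - i)%N else (k == 0)%:R.

Lemma hsym0 s : hsym s 0 = 1.
Proof. by elim: s => //= x s IH; rewrite big_ord1 IH mul1r. Qed.

Lemma hsymS x s k : hsym (x :: s) k.+1 = hsym s k.+1 + x * hsym (x :: s) k.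
Proof.
rewrite /= big_ord_recl mul1r; congr (_ + _).
by rewrite mulr_sumr; apply: eq_bigr => i _; rewrite lift0 subSS exprS mulrA.
Qed.

(* The divided difference of [u^l] at the points [s]. *)
Definition dd_mon s l : A :=
  if (size s <= l.+1)%N then hsym s (l.+1 - size s)%N else 0.

Lemma dd_mon_cons0 x s : dd_mon (x :: s) 0 = (s == [::])%:R.
Proof. by case: s => [|y s]; rewrite /dd_mon //= subnn big_ord1 mulr1. Qed.

(** Leibniz rule for the product of u and u^l, equivalent to h_(k+1)(x,s) = h_(k+1)(s) + x
    h_k(x,s). *)
Lemma dd_monS x s l : dd_mon (x :: s) l.+1 = x * dd_mon (x :: s) l + dd_mon s l.
Proof.
rewrite /dd_mon [size (x :: s)]/= !ltnS !subSS.
case: (ltngtP (size s) l.+1) => [sl|sl|sl]; last 1 first.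
- by rewrite sl ltnn subnn !hsym0 mulr0 add0r.
- by rewrite -ltnS sl subSn -1?ltnS // hsymS addrC.
- by rewrite leqNgt (ltnW sl) mulr0 addr0.
Qed.

(* The divided difference of [p] at the points [s], with [size p <= M]. *)
Definition dd s M p : A := \sum_(l < M) p`_l * dd_mon s l.

Lemma dd_nil M p : dd [::] M p = 0.
Proof. by rewrite /dd big1 // => l _; rewrite mulr0. Qed.

Lemma ddD s M p q : dd s M (p + q) = dd s M p + dd s M q.
Proof.
by rewrite /dd -big_split; apply: eq_bigr => l _; rewrite coefD mulrDl.
Qed.

Lemma ddZ s M a p : dd s M (a *: p) = a * dd s M p.
Proof.
by rewrite /dd mulr_sumr; apply: eq_bigr => l _; rewrite coefZ mulrA.
Qed.

Lemma dd_sum s M (I : finType) (P : pred I) (f : I -> {poly A}) :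
  dd s M (\sum_(i | P i) f i) = \sum_(i | P i) dd s M (f i).
Proof.
apply: (big_morph (dd s M)); first exact: ddD.
by rewrite /dd big1 // => l _; rewrite coef0 mul0r.
Qed.

Lemma ddXn s M l : (l < M)%N -> dd s M 'X^l = dd_mon s l.
Proof.
move=> lM; rewrite /dd (bigD1 (Ordinal lM)) //= coefXn eqxx mul1r.
rewrite big1 ?addr0 // => i; rewrite -val_eqE /= => il.
by rewrite coefXn (negbTE il) mul0r.
Qed.

(** Euclidean division by u - x removes the point x, so no difference of points is ever inverted.
    The constant remainder survives only when x is the single point. *)
Lemma dd_consE x s M q c : (size q <= M)%N ->
  dd (x :: s) M.+1 (q * ('X - x%:P) + c%:P) = dd s M q + (s == [::])%:R * c.
Proof.
move=> qM; rewrite ddD; congr (_ + _); last first.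
  rewrite /dd big_ord_recl big1 => [|i _]; last by rewrite coefC mul0r.
  by rewrite coefC addr0 dd_mon_cons0 mulrC.
have -> : q * ('X - x%:P) = q * 'X + (- x) *: q.
  by rewrite mulrBr scaleNr -mul_polyC [x%:P * _]mulrC.
rewrite ddD ddZ /dd big_ord_recl coefMX mul0r add0r.
rewrite [X in _ + _ * X]big_ord_recr /= nth_default // mul0r addr0 mulr_sumr.
rewrite -big_split; apply: eq_bigr => i _.
by rewrite /bump /= add1n coefMX dd_monS /=; ring.
Qed.

End CompleteHomogeneous.

(** * Divided differences modulo powers of z *)

Section DividedDifferenceOrder.
Variable F : fieldType.
Local Notation A := {poly F}.
Implicit Types (p q d : A).

Definition vanish n p := forall k, (k < n)%N -> p`_k = 0.

Lemma vanishW m n p : (m <= n)%N -> vanish n p -> vanish m p.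
Proof. by move=> mn pn k km; apply/pn/leq_trans/mn. Qed.

Lemma vanishD n p q : vanish n p -> vanish n q -> vanish n (p + q).
Proof. by move=> pn qn k kn; rewrite coefD pn ?qn ?addr0. Qed.

Lemma vanishN n p : vanish n p -> vanish n (- p).
Proof. by move=> pn k kn; rewrite coefN pn ?oppr0. Qed.

Lemma vanishM n p q : vanish n p -> vanish n (q * p).
Proof.
move=> pn k kn; rewrite coefM big1 // => i _.
by rewrite pn ?mulr0 // (leq_ltn_trans (leq_subr _ _)).
Qed.

(** Here d has valuation exactly 1, so dividing by it costs one order. *)
Lemma vanish_cancel n d q :
  d`_0 = 0 -> d`_1 != 0 -> vanish n.+1 (d * q) -> vanish n q.
Proof.
move=> d0 d1 dq k; elim/ltn_ind: k => k IH kn.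
have := dq k.+1 kn; rewrite coefM !big_ord_recl d0 mul0r add0r big1 ?addr0.
  by rewrite lift0 subSS subn0 => /eqP; rewrite mulf_eq0 (negbTE d1) => /eqP.
move=> i _; rewrite !lift0 subSS IH ?mulr0 //; have := ltn_ord i; lia.
Qed.

Definition separated (x y : A) := ((x - y)`_0 == 0) && ((x - y)`_1 != 0).

(** Each point after the first costs one order: if q is the quotient of p by u - x, then (x-z) q(z)
    = p(x) - p(z), so q vanishes to order n-1 at every remaining point z. *)
Lemma dd_vanish (s : seq A) n M (p : {poly A}) :
  (size p <= M)%N -> (size s <= n.+1)%N -> pairwise separated s ->
  (forall x, x \in s -> vanish n p.[x]) -> vanish (n.+1 - size s) (dd s M p).
Proof.
elim: s n M p => [|x s IH] n M p pM sn; first by rewrite dd_nil => _ _ k _; rewrite coef0.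
case: M pM => [|M] pM.
  by rewrite /dd big_ord0 => _ _ k _; rewrite coef0.
rewrite pairwise_cons => /andP[/allP xs ss] px.
have /factor_theorem[q Eq] : root (p - p.[x]%:P) x.
  by rewrite /root !hornerE subrr.
have {Eq} Ep : p = q * ('X - x%:P) + p.[x]%:P by rewrite -Eq subrK.
have qM : (size q <= M)%N.
  have [->|q0] := eqVneq q 0; first by rewrite size_poly0.
  have : (size (p - p.[x]%:P)%R <= M.+1)%N.
    rewrite (leq_trans (size_polyD _ _)) // geq_max pM size_polyN.
    by rewrite (leq_trans (size_polyC_leq1 _)).
  by rewrite {1}Ep addrK size_mul ?polyXsubC_eq0 // size_XsubC addn2.
rewrite {1}Ep dd_consE //; apply: vanishD; last first.
  apply: vanishM; apply: vanishW (px x (mem_head _ _)) => /=; lia.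
case: s => [|y s] in IH sn xs ss px *; first by rewrite dd_nil => k _; rewrite coef0.
have -> : (n.+1 - size [:: x, y & s] = n.-1.+1 - size (y :: s))%N by move: sn => /=; lia.
apply: IH => //; first by move: sn => /=; lia.
move=> z zs.
have n0 : n = n.-1.+1 by move: sn => /=; lia.
have /andP[/eqP d0 d1] := xs _ zs.
apply: (@vanish_cancel _ (x - z)) => //; rewrite -n0.
have -> : (x - z) * q.[z] = p.[x] + - p.[z].
  by rewrite {2}Ep !hornerE; ring.
apply: vanishD; first by apply: px; rewrite mem_head.
by apply: vanishN; apply: px; rewrite in_cons zs orbT.
Qed.

End DividedDifferenceOrder.

(** * The conjugate roots of the kernel *)

Section PowerSeriesRoot.
Variables (F : numFieldType) (h N : nat).
Hypothesis hpos : (0 < h)%N.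
Local Notation c := (ufactor F h).

(* The conjugate branch [U(w z)], truncated at order [N]. *)
Definition branch (w : F) : {poly F} := \poly_(n < N) (c 1 n * w ^+ n).

Lemma coef_branch_exp w i n : (n < N)%N -> (branch w ^+ i)`_n = c i n * w ^+ n.
Proof.
elim: i n => [|i IH] n nN.
  by rewrite expr0 coef1 ufactor0n; case: n nN => [|n] _; rewrite ?mulr1 ?mul0r.
rewrite exprS coefM -[i.+1]add1n -ufactorM // mulr_suml; apply: eq_bigr => l _.
have ln : (l <= n)%N by rewrite -ltnS.
rewrite IH ?(leq_ltn_trans (leq_subr _ _)) // coef_poly (leq_ltn_trans ln) //.
by rewrite mulrACA -exprD subnKC.
Qed.

(** The kernel K(u) = u^h - z^h (1 + Q(u)) at u = x, with ['X] as z. At a truncated root it is only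
    zero up to order N. *)
Definition kernel_defect (x : {poly F}) : {poly F} :=
  x ^+ h - 'X^h * \sum_(l < (2 * h).+1 | l != h :> nat) x ^+ l.

(** Since w^h = 1, the factor z^h is unchanged by z -> w z, so U(w z) satisfies the same equation as
    U(z). *)
Lemma branch_kernel w : w ^+ h = 1 -> vanish N (kernel_defect (branch w)).
Proof.
move=> wh n nN; rewrite coefB coefXnM coef_branch_exp //.
case: ltnP => hn; first by rewrite ufactor_gt // mul0r subr0.
rewrite -{1 2}(subnK hn) ufactor_hstep // exprD wh mulr1 coef_sum mulr_suml.
rewrite -sumrB big1 // => l _.
by rewrite coef_branch_exp ?subrr // (leq_ltn_trans (leq_subr _ _)).
Qed.

Lemma branch_separated w v : (1 < N)%N -> w != v -> separated (branch w) (branch v).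
Proof.
move=> N1 wv; rewrite /separated !coefB -[branch w]expr1 -[branch v]expr1.
rewrite !coef_branch_exp ?(ltnW N1) // ufactorn0 !mul0r subrr eqxx /=.
have -> : c 1 1 = 1 by rewrite -{2}[1%N]addn0 ufactorE // binomstar0 addn0 divr1 mul1r.
by rewrite !mul1r subr_eq0.
Qed.

(** Divided difference of u^k K(u) at h roots of K. With h points, u^(k+h) yields h_(k+1), and h-1
    orders of precision are lost. *)
Lemma hsym_kernel (s : seq {poly F}) k :
  size s = h -> (h <= N.+1)%N -> pairwise (@separated F) s ->
  (forall x, x \in s -> vanish N (kernel_defect x)) ->
  vanish (N.+1 - h) (hsym s k.+1 -
    'X^h * \sum_(l < (2 * h).+1 | l != h :> nat) dd_mon s (k + l)).
Proof.
move=> sh hN sep ker.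
(* This is u^k K(u), a polynomial in u with coefficients in z. *)
pose p : {poly {poly F}} := 'X^(k + h) +
  (- 'X^h) *: \sum_(l < (2 * h).+1 | l != h :> nat) 'X^(k + l).
have pM : (size p <= (k + 2 * h).+1)%N.
  rewrite (leq_trans (size_polyD _ _)) // geq_max size_polyXn; apply/andP; split.
    by lia.
  rewrite (leq_trans (size_scale_leq _ _)) //; apply: (leq_trans (size_sum _ _ _)).
  by apply/bigmax_leqP => l _; rewrite size_polyXn; have := ltn_ord l; lia.
have := @dd_vanish F s N _ p pM; rewrite sh => /(_ hN sep).
rewrite ddD ddXn; last by lia.
rewrite ddZ dd_sum mulNr.
have -> : dd_mon s (k + h) = hsym s k.+1.
  by rewrite /dd_mon sh -addSn leq_addl addnK.
under eq_bigr => l _ do rewrite ddXn ?ltnS ?leq_add2l -1?ltnS //.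
apply=> x xs; have -> : p.[x] = x ^+ k * kernel_defect x.
  rewrite /p hornerD hornerZ hornerXn horner_sum /kernel_defect mulNr.
  rewrite mulrBr -exprD [x ^+ k * ('X^h * _)]mulrCA [x ^+ k * \sum_(_ | _) _]mulr_sumr.
  by congr (_ - _ * _); apply: eq_bigr => l _; rewrite hornerXn exprD.
exact/vanishM/ker.
Qed.

End PowerSeriesRoot.

(** * Positive walks and their last step recurrence *)

Section Walks.
Variable h : nat.
Local Notation S := 'I_(2 * h).
Implicit Types (n : nat) (k : int).

Lemma positive_walkP n (w : {ffun 'I_n -> S}) :
  reflect (forall i, (0 < i <= n)%N -> 1 <= alt w i) (positive_walk w).
Proof.
apply: (iffP forallP) => [H i /andP[i0 ni]|H i].
  by have /implyP := H (Ordinal (ni : (i < n.+1)%N)); apply.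
by apply/implyP => i0; apply: H; rewrite i0 -ltnS ltn_ord.
Qed.

Lemma nb_pos_walksE n k :
  nb_pos_walks h n k =
  (\sum_(w : {ffun 'I_n -> S}) (positive_walk w && (alt w n == k)))%N.
Proof.
rewrite /nb_pos_walks -sum1_card.
rewrite [RHS](eq_bigr (fun w => if positive_walk w && (alt w n == k) then 1%N else 0%N)).
  by rewrite -big_mkcond; apply: eq_bigl => w; rewrite inE.
by move=> w _; case: ifP.
Qed.

Definition extend n (wj : {ffun 'I_n -> S} * S) : {ffun 'I_n.+1 -> S} :=
  [ffun i => oapp wj.1 wj.2 (unlift ord_max i)].

Lemma extend_bij n : bijective (@extend n).
Proof.
exists (fun w : {ffun 'I_n.+1 -> S} =>
  ([ffun i : 'I_n => w (lift ord_max i)], w ord_max)).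
  move=> [w j]; rewrite /extend ffunE unlift_none; congr pair.
  by apply/ffunP => i; rewrite !ffunE liftK.
move=> w; apply/ffunP => i; rewrite !ffunE.
by case: unliftP => [l|] -> //=; rewrite ffunE.
Qed.

Lemma alt_extend n w j i : (i <= n)%N -> alt (@extend n (w, j)) i = alt w i.
Proof.
move=> ni; rewrite /alt big_mkcond big_ord_recr /= ltnNge ni /= addr0.
rewrite [RHS]big_mkcond; apply: eq_bigr => l _ /=; case: ifP => // _.
rewrite ffunE (_ : widen_ord _ l = lift ord_max l) ?liftK //.
by apply: val_inj; rewrite /= /bump leqNgt ltn_ord.
Qed.

Lemma alt_extend_last n w j :
  alt (@extend n (w, j)) n.+1 = alt w n + step j.
Proof.
rewrite /alt big_mkcond big_ord_recr /= ltnSn ffunE unlift_none /=; congr (_ + _).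
rewrite [RHS]big_mkcond; apply: eq_bigr => l _ /=; rewrite ltn_ord ltnS ltnW //.
rewrite ffunE (_ : widen_ord _ l = lift ord_max l) ?liftK //.
by apply: val_inj; rewrite /= /bump leqNgt ltn_ord.
Qed.

Lemma positive_extend n w j :
  positive_walk (@extend n (w, j)) = positive_walk w && (1 <= alt w n + step j).
Proof.
apply/positive_walkP/andP => [H|[/positive_walkP H jH] i /andP[i0]].
  split; last by rewrite -alt_extend_last H //=.
  apply/positive_walkP => i /andP[i0 ni]; rewrite -(alt_extend w j ni).
  by rewrite H // i0 leqW.
rewrite leq_eqVlt => /predU1P[->|ni]; first by rewrite alt_extend_last.
by rewrite alt_extend // H // i0.
Qed.

Lemma alt0 (w : {ffun 'I_0 -> S}) i : alt w i = 0.
Proof. by rewrite /alt big_ord0. Qed.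

Lemma positive0 (w : {ffun 'I_0 -> S}) : positive_walk w.
Proof. by apply/positive_walkP => -[|i]. Qed.

Lemma nb_pos_walks0 k : nb_pos_walks h 0 k = (k == 0).
Proof.
rewrite nb_pos_walksE (eq_bigr (fun=> (k == 0) : nat)).
  by rewrite sum_nat_const card_ffun !card_ord expn0 mul1n.
by move=> w _; rewrite positive0 alt0 eq_sym.
Qed.

Lemma nb_pos_walks_le0 n k : k <= 0 -> nb_pos_walks h n.+1 k = 0%N.
Proof.
move=> k0; rewrite nb_pos_walksE big1 // => w _; apply/eqP; rewrite eqb0.
apply/negP => /andP[/positive_walkP /(_ n.+1) H /eqP kE].
by move: H; rewrite kE ltnS leqnn => /(_ isT); rewrite leNgt (le_lt_trans k0).
Qed.

Lemma nb_pos_walks_lt0 n k : k < 0 -> nb_pos_walks h n k = 0%N.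
Proof.
case: n => [|n] k0; first by rewrite nb_pos_walks0 lt_eqF.
by rewrite nb_pos_walks_le0 // ltW.
Qed.

(** Removing the last step: as k >= 1, the endpoint is automatically admissible and only the prefix
    has to be positive. *)
Lemma nb_pos_walksS n k : 1 <= k ->
  nb_pos_walks h n.+1 k = (\sum_(j < 2 * h) nb_pos_walks h n (k - step j))%N.
Proof.
move=> k1; rewrite nb_pos_walksE (reindex (@extend n)) /=; last exact/onW_bij/extend_bij.
under [RHS]eq_bigr => j _ do rewrite nb_pos_walksE.
rewrite exchange_big pair_bigA; apply: eq_bigr => -[w j] _ /=.
rewrite positive_extend alt_extend_last -andbA; congr (nat_of_bool (_ && _)).
by rewrite [RHS]eq_sym subr_eq [k == _]eq_sym; case: eqP => [->|]; rewrite ?k1 ?andbF.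
Qed.

(* Reparametrizes the [2h] steps by [l <> h] in [[0, 2h]], the step being [h - l]. *)
Lemma sum_steps (f : int -> nat) k :
  (\sum_(j < 2 * h) f (k - step j)%R =
   \sum_(l < (2 * h).+1 | l != h :> nat) f (k + l%:Z - h%:Z)%R)%N.
Proof.
pose g l := f (k + l%:Z - h%:Z).
rewrite -(big_mkord (fun l => l != h) g) (@big_cat_nat _ _ _ h) //=; last by lia.
rewrite -(big_mkord xpredT
  (fun j => f (k - if (j < h)%N then j.+1%:Z else - (j - h).+1%:Z))).
rewrite (@big_cat_nat _ _ _ h) //=; last by lia.
congr (_ + _)%N.
  rewrite [RHS]big_nat_cond [RHS](eq_bigl (fun l => 0 <= l < h)%N); last by move=> l; lia.
  (* The up step j+1 corresponds to l = h-1-j, hence the reversal. *)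
  rewrite -big_nat [RHS]big_nat_rev big_nat [RHS]big_nat /=.
  apply: eq_bigr => j jh; rewrite (jh : (j < h)%N) /g; congr f; lia.
(* The excluded index l = h would be a zero step; beyond it, the down step of index j corresponds to
   l = j+1. *)
rewrite [RHS]big_ltn_cond ?eqxx; last by lia.
rewrite [RHS]big_nat_cond [RHS](eq_bigl (fun l => h.+1 <= l < (2 * h).+1)%N);
  last by move=> l; lia.
rewrite -big_nat big_add1 /= big_nat [RHS]big_nat.
apply: eq_bigr => j /andP[hj _]; rewrite ltnNge hj /g /=; congr f; lia.
Qed.

Lemma alt_le n (w : {ffun 'I_n -> S}) : alt w n <= (n * h)%:Z.
Proof.
apply: (@le_trans _ _ (\sum_(l < n) h%:Z)).
  rewrite /alt (eq_bigl xpredT) => [|l]; last by rewrite ltn_ord.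
  by apply: ler_sum => l _; rewrite /step; case: ltnP => H; lia.
by rewrite sumr_const card_ord -mulr_natr mulrC PoszM natz.
Qed.

(** Meanders are sorted by their final altitude, which is at most n h; altitude 0 is reached by the
    empty walk only. *)
Lemma nb_pos_meandersE n :
  nb_pos_meanders h n = (\sum_(k < (n * h).+1) nb_pos_walks h n k%:Z)%N.
Proof.
rewrite /nb_pos_meanders -sum1_card.
under [RHS]eq_bigr => k _ do rewrite nb_pos_walksE.
rewrite exchange_big big_mkcond; apply: eq_bigr => w _; rewrite inE.
case: ifP => [pw|_]; last by rewrite big1.
have a0 : 0 <= alt w n.
  case: n w pw => [|n] w pw; first by rewrite alt0.
  by apply: le_trans (positive_walkP _ pw n.+1 _); rewrite //= leqnn.
have aE := gez0_abs a0.
have an : (`|alt w n| < (n * h).+1)%N by rewrite ltnS -lez_nat aE alt_le.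
rewrite (bigD1 (Ordinal an)) //= aE eqxx big1 // => i.
by rewrite -val_eqE /= => /negbTE i0; rewrite -aE eqz_nat eq_sym i0.
Qed.

End Walks.

(** * Coefficient extraction as sums over exponent tuples *)

Section CoefficientSums.
Variable A : comNzRingType.

Lemma coef_prod_ffun (I : finType) (f : I -> {poly A}) m M : (m <= M)%N ->
  (\prod_i f i)`_m =
  \sum_(e : {ffun I -> 'I_M.+1} | (\sum_i (e i : nat) == m)%N) \prod_i (f i)`_(e i).
Proof.
move=> mM; pose g i := \poly_(k < M.+1) (f i)`_k.
(* Truncating every factor beyond degree M does not change the coefficients up to m. *)
have fg : forall k, (k <= m)%N -> (\prod_i f i)`_k = (\prod_i g i)`_k.
  apply: (big_ind2 (fun p q : {poly A} => forall k, (k <= m)%N -> p`_k = q`_k)) => //.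
  - move=> p p' q q' pp qq k km; rewrite !coefM; apply: eq_bigr => l _.
    by have := ltn_ord l => lk; rewrite pp ?qq //; lia.
  - by move=> i _ k km; rewrite coef_poly ifT // ltnS (leq_trans km).
rewrite fg //.
under eq_bigr => i _ do rewrite /g poly_def.
rewrite bigA_distr_bigA coef_sum [RHS]big_mkcond; apply: eq_bigr => e _ /=.
rewrite scaler_prod prodrXr coefZ coefXn eq_sym.
by case: ifP; rewrite ?mulr1 ?mulr0.
Qed.

(** Generating function of the h_k: the product of the geometric series 1/(1 - x t), truncated
    beyond degree M. *)
Lemma hsym_coef_geometric (s : seq A) k M : (k <= M)%N ->
  hsym s k = (\prod_(x <- s) \poly_(i < M.+1) x ^+ i)`_k.
Proof.
elim: s k => [|x s IH] k kM; first by rewrite big_nil coef1.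
rewrite big_cons coefM; apply: eq_bigr => i _; have := ltn_ord i => ik.
rewrite coef_poly ifT; last by lia.
by congr (_ * _); apply: IH; lia.
Qed.

Lemma hsymE n (f : 'I_n -> A) k M : (k <= M)%N ->
  hsym [seq f j | j <- enum 'I_n] k =
  \sum_(e : {ffun 'I_n -> 'I_M.+1} | (\sum_j (e j : nat) == k)%N) \prod_j f j ^+ e j.
Proof.
move=> kM; rewrite (hsym_coef_geometric _ kM) big_map big_enum /=.
rewrite (coef_prod_ffun _ kM); apply: eq_bigr => e _; apply: eq_bigr => j _.
by rewrite coef_poly ltn_ord.
Qed.

End CoefficientSums.

Lemma hsym_coef0 (F : fieldType) (s : seq {poly F}) k :
  (forall x, x \in s -> x`_0 = 0) -> (hsym s k)`_0 = (k == 0)%:R.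
Proof.
elim: s k => [|x s IH] k s0; first by rewrite /= -polyC_natr coefC.
rewrite /= coef_sum big_ord_recl expr0 mul1r subn0 IH => [|y ys]; last first.
  by rewrite s0 // in_cons ys orbT.
rewrite big1 ?addr0 // => i _; rewrite lift0 coefM big_ord1.
by rewrite coef_exp_small ?mul0r // s0 ?mem_head.
Qed.

(** * Walk counts from h distinct h-th roots of unity *)

Section WalkCount.
Variables (F : numFieldType) (h : nat) (w : 'I_h -> F).
Hypotheses (hpos : (0 < h)%N) (winj : injective w) (wh : forall j, w j ^+ h = 1).
Local Notation c := (ufactor F h).

Definition branches N := [seq branch h N (w j) | j <- enum 'I_h].

Lemma size_branches N : size (branches N) = h.
Proof. by rewrite size_map size_enum_ord. Qed.

Lemma branches_separated N : (1 < N)%N -> pairwise (@separated F) (branches N).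
Proof.
move=> N1; rewrite pairwise_map.
have := enum_uniq 'I_h; rewrite uniq_pairwise; apply: sub_pairwise => i j /= ij.
by apply: branch_separated => //; apply: contra_neq ij => /winj.
Qed.

(** Both sides obey the last step recurrence in n. The bound on N keeps the coefficient n h below
    N+1-h, the precision left by the divided difference; 1 < N keeps the linear terms that separate
    the branches. *)
Lemma nb_pos_walks_hsym N n k : (1 < N)%N -> (n * h + h < N.+1)%N ->
  (nb_pos_walks h n k%:Z)%:R = (hsym (branches N) k)`_(n * h) :> F.
Proof.
move=> N1; elim: n k => [|n IH] k nN.
  rewrite nb_pos_walks0 mul0n hsym_coef0 // => x /mapP[j _ ->].
  by rewrite -[branch _ _ _]expr1 coef_branch_exp ?ufactorn0 ?mul0r //; lia.
case: k => [|k].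
  by rewrite nb_pos_walks_le0 // hsym0 coef1 muln_eq0 /= gtn_eqF.
have kernel x : x \in branches N -> vanish N (kernel_defect h x).
  by move=> /mapP[j _ ->]; apply: branch_kernel.
have hN : (h <= N.+1)%N by lia.
have mN : (n.+1 * h < N.+1 - h)%N by lia.
have := hsym_kernel hpos k (size_branches N) hN (branches_separated N1) kernel mN.
rewrite coefB => /eqP; rewrite subr_eq0 => /eqP ->.
rewrite coefXnM mulSn ltnNge leq_addr /= addKn coef_sum.
rewrite nb_pos_walksS // sum_steps natr_sum; apply: eq_bigr => l _.
(* If k+l+1 < h the previous altitude is negative: no walk ends there, and [dd_mon] is 0. *)
rewrite /dd_mon size_branches; case: leqP => hl; last first.
  by rewrite coef0 nb_pos_walks_lt0 //; lia.
by rewrite -IH; [congr (nb_pos_walks _ _ _)%:R; lia | lia].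
Qed.

Lemma hsym_branches N m k M : (m < N)%N -> (k <= M)%N ->
  (hsym (branches N) k)`_m =
  \sum_(nn : {ffun 'I_h -> 'I_m.+1} | (\sum_j (nn j : nat) == m)%N)
   \sum_(ii : {ffun 'I_h -> 'I_M.+1} | (\sum_j (ii j : nat) == k)%N)
     \prod_j (c (ii j) (nn j) * w j ^+ nn j).
Proof.
move=> mN kM; rewrite (hsymE _ kM) coef_sum exchange_big.
apply: eq_bigr => ii _; rewrite (coef_prod_ffun _ (leqnn m)).
apply: eq_bigr => nn _; apply: eq_bigr => j _.
by rewrite coef_branch_exp // (leq_ltn_trans _ mN) // -ltnS.
Qed.

(** The bound M on the exponents is left free so that meanders can use n h for all k at once. *)
Lemma nb_pos_walks_sum n k M : (k <= M)%N ->
  (nb_pos_walks h n k%:Z)%:R =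
  \sum_(nn : {ffun 'I_h -> 'I_(n * h).+1} | (\sum_j (nn j : nat) == n * h)%N)
   \sum_(ii : {ffun 'I_h -> 'I_M.+1} | (\sum_j (ii j : nat) == k)%N)
     \prod_j (c (ii j) (nn j) * w j ^+ nn j).
Proof.
move=> kM; rewrite (@nb_pos_walks_hsym (n * h + h).+1) ?ltnS //; last by lia.
by rewrite (@hsym_branches _ _ _ M) //; lia.
Qed.

Lemma nb_pos_meanders_sum n :
  (nb_pos_meanders h n)%:R =
  \sum_(nn : {ffun 'I_h -> 'I_(n * h).+1} | (\sum_j (nn j : nat) == n * h)%N)
   \sum_(ii : {ffun 'I_h -> 'I_(n * h).+1})
     \prod_j (c (ii j) (nn j) * w j ^+ nn j).
Proof.
rewrite nb_pos_meandersE natr_sum.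
under eq_bigr => k _ do rewrite (@nb_pos_walks_sum n k (n * h)) -1?ltnS //.
rewrite exchange_big; apply: eq_bigr => nn /eqP nnE.
under eq_bigr => k _ do rewrite big_mkcond.
rewrite exchange_big; apply: eq_bigr => ii _ /=.
(* A tuple of sum at most n h is counted for exactly one k. A larger sum forces i_j > n_j for some
   j, and that factor is 0. *)
have [small|big] := ltnP (\sum_j (ii j : nat))%N (n * h).+1.
  rewrite (bigD1 (Ordinal small)) //= eqxx [X in _ + X]big1 ?addr0 // => k.
  by rewrite -val_eqE /= eq_sym => /negbTE ->.
have [j nnii] : exists j, (nn j < ii j)%N.
  apply/existsP; apply: contraLR big; rewrite negb_exists => /forallP le.
  rewrite -leqNgt; apply: leq_trans (eq_leq nnE).
  by apply: leq_sum => j _; rewrite leqNgt le.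
have -> : \prod_i (c (ii i) (nn i) * w i ^+ nn i) = 0.
  by rewrite (bigD1 j) //= ufactor_gt // !mul0r.
by rewrite big1 // => k _; rewrite if_same.
Qed.

End WalkCount.

(** * The primitive root of unity omega *)

Section Omega.
Variables (R : realType) (h : nat).
Hypothesis hpos : (0 < h)%N.

Lemma omega_exp j :
  omega R h ^+ j = (cos (2 * pi / h%:R *+ j) +i* sin (2 * pi / h%:R *+ j))%C.
Proof.
elim: j => [|j IH]; first by rewrite expr0 mulr0n cos0 sin0.
rewrite exprS IH [_ *+ j.+1]mulrS cosD sinD /omega; apply/eqP.
by rewrite eq_complex /= eqxx addrC mulrC eqxx.
Qed.

Lemma omega_expn_order : omega R h ^+ h = 1.
Proof.
rewrite omega_exp -[_ *+ h]mulr_natr divfK ?pnatr_eq0 -?lt0n //.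
by rewrite mulr_natl cos2pi sin2pi.
Qed.

Lemma omega_exp_neq1 d : (0 < d < h)%N -> omega R h ^+ d != 1.
Proof.
move=> /andP[d0 dh]; rewrite omega_exp; apply/eqP => -[cos1 _].
(* Half the angle of omega^d, in (0, pi): cos(2x) = 1 - 2 sin(x)^2 is then different from 1. *)
pose x : R := pi * (d%:R / h%:R).
have h0 : 0 < h%:R :> R by rewrite ltr0n.
have x0 : 0 < sin x.
  apply: sin_gt0_pi; rewrite mulr_gt0 ?pi_gt0 ?divr_gt0 ?ltr0n //=.
  by rewrite gtr_pMr ?pi_gt0 // ltr_pdivrMr // mul1r ltr_nat.
move: cos1; have -> : 2 * pi / h%:R *+ d = x *+ 2.
  by rewrite /x mulr2n -[LHS]mulr_natr; field; rewrite gt_eqF.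
rewrite cos_mulr2n cos2sin2 => /eqP.
have : 0 < sin x ^+ 2 by rewrite exprn_gt0.
by move: (sin x ^+ 2) => y y0 /eqP; lra.
Qed.

Lemma omega_exp_inj : injective (fun j : 'I_h => omega R h ^+ j).
Proof.
have nz : omega R h != 0.
  apply/eqP => w0; have /eqP := omega_expn_order.
  by rewrite w0 expr0n gtn_eqF // eq_sym oner_eq0.
have aux (i j : 'I_h) : (i < j)%N -> omega R h ^+ i <> omega R h ^+ j.
  move=> ij /eqP; rewrite -(subnK (ltnW ij)) exprD -{1}[_ ^+ i]mul1r.
  rewrite (inj_eq (mulIf _)) ?expf_neq0 // eq_sym; apply/negP.
  by apply: omega_exp_neq1; have := ltn_ord j; lia.
move=> i j /= E; apply/val_inj; case: (ltngtP i j) => // [/aux|/aux] //.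
by rewrite E.
Qed.

Lemma prod_omega (f : 'I_h -> R[i]) (nn : 'I_h -> nat) :
  \prod_j (f j * (omega R h ^+ j) ^+ nn j) =
  \prod_j f j * omega R h ^+ (\sum_(j < h) (j : nat) * nn j)%N.
Proof.
rewrite big_split /=; congr (_ * _); rewrite -prodrXr.
by apply: eq_bigr => j _; rewrite exprM.
Qed.

End Omega.

(** * The two formulas, at the roots of unity omega^j for j < h *)

Theorem theorem4p11 (R : realType) (h : nat) (hpos : (1 <= h)%N) :
  (forall (k : nat) (n : nat), (1 <= k)%N ->
     (nb_pos_walks h n k)%:R =
     \sum_(nn : {ffun 'I_h -> 'I_(n * h).+1} | (\sum_(j < h) (nn j : nat) == n * h)%N)
       \sum_(ii : {ffun 'I_h -> 'I_k.+1} | (\sum_(j < h) (ii j : nat) == k)%N)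
         (\prod_(j < h) ufactor [the fieldType of R[i]] h (ii j) (nn j))
           * omega R h ^+ (\sum_(j < h) (j : nat) * nn j)%N) /\
  (forall n : nat,
     (nb_pos_meanders h n)%:R =
     \sum_(nn : {ffun 'I_h -> 'I_(n * h).+1} | (\sum_(j < h) (nn j : nat) == n * h)%N)
       \sum_(ii : {ffun 'I_h -> 'I_(n * h).+1})
         (\prod_(j < h) ufactor [the fieldType of R[i]] h (ii j) (nn j))
           * omega R h ^+ (\sum_(j < h) (j : nat) * nn j)%N).
Proof.
have winj := @omega_exp_inj R h hpos.
have wh (j : 'I_h) : (omega R h ^+ j) ^+ h = 1.
  by rewrite exprAC omega_expn_order // expr1n.
split=> [k n _|n].
  rewrite (nb_pos_walks_sum hpos winj wh n (leqnn k)).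
  by apply: eq_bigr => nn _; apply: eq_bigr => ii _; rewrite prod_omega.
rewrite (nb_pos_meanders_sum hpos winj wh n).
by apply: eq_bigr => nn _; apply: eq_bigr => ii _; rewrite prod_omega.
Qed.
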